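(* Let $d,m$ be nonnegative integers and $t$ a positive integer. Then $$\binom{d+m+t}{d+m}\le HG(t,QA^d_m)\le \sum_{i=0}^{d+m}t^i .$$
   Context: A family of sets is a set $F$ of sets (its members are distinct). For a family $F$ put $F^0=F$ and, inductively, $F^{k+1}=\{A\cap B:\ A,B\in F^k,\ A\neq B\}$. A family $F$ has the $[d,m]$-property if $|A|\le d$ for every $A\in F^m$; $QA^d_m$ denotes the class of all families with the $[d,m]$-property. A set $X$ with $|X|\le t$ is a $t$-transversal of $F$ if $X\cap A\neq\emptyset$ for every $A\in F$. For a family $F$, $HG(t,F)$ is the least nonnegative integer $k$ such that: if every subfamily $P\subseteq F$ with $|P|\le k$ has a $t$-transversal, then $F$ has a $t$-transversal ($HG(t,F)=\infty$ if no such $k$ exists). For a class $\mathcal C$ of families, $HG(t,\mathcal C)=\sup_{F\in\mathcal C}HG(t,F)$. *)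

(* Defs.v *)
From HB Require Import structures.
From mathcomp Require Import all_boot all_order all_algebra.
From mathcomp Require Import all_classical all_reals ereal.

Set Implicit Arguments.
Unset Strict Implicit.
Unset Printing Implicit Defensive.

Import Order.TTheory GRing.Theory Num.Theory.

Local Open Scope classical_set_scope.
Local Open Scope card_scope.
Local Open Scope ring_scope.

(* Families may be infinite and may have infinite members: [|A| <= n] is
   rendered as [A #<= `I_n], i.e. A injects into {0, ..., n-1}. *)

Fixpoint iter_inter (T : Type) (F : set (set T)) (k : nat) : set (set T) :=
  if k is k'.+1 then
    [set C | exists A B, [/\ iter_inter F k' A, iter_inter F k' B, A <> B
                           & C = A `&` B]]
  else F.

Definition dm_property (d m : nat) (T : Type) (F : set (set T)) : Prop :=
  forall A, iter_inter F m A -> A #<= `I_d.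

Definition transversal (t : nat) (T : Type) (F : set (set T)) (X : set T) :
    Prop :=
  X #<= `I_t /\ forall A, F A -> X `&` A !=set0.

Definition has_transversal (t : nat) (T : Type) (F : set (set T)) : Prop :=
  exists X, transversal t F X.

Definition helly_at (t : nat) (T : Type) (F : set (set T)) (k : nat) : Prop :=
  (forall P, P `<=` F -> P #<= `I_k -> has_transversal t P) ->
  has_transversal t F.

(* The realType R only serves to provide the extended numbers in which values
   in nat together with +oo, and their suprema, live. *)
Definition HG (R : realType) (t : nat) (T : Type) (F : set (set T)) : \bar R :=
  if pselect (exists k, `[< helly_at t F k >]) is left ex_k
  then ((ex_minn ex_k)%:R)%:E else +oo%E.

(* A class of families ranges over all ground types. *)
Definition family_class := forall T : Type, set (set (set T)).

Definition QA (d m : nat) : family_class :=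
  fun T => [set F | dm_property d m F].

Definition HG_class (R : realType) (t : nat) (C : family_class) : \bar R :=
  ereal_sup [set x | exists (T : Type) (F : set (set T)),
                       C T F /\ x = HG R t F].

(* Main.v *)
Require Import Defs.
From mathcomp Require Import all_boot all_order all_algebra.
From mathcomp Require Import all_classical all_reals ereal.
From mathcomp Require Import zify.

(** Distinct sets of size at most d meet in fewer than d points, so QA^d_m is
    contained in QA^0_{d+m}, and the (d+m)-uniform families lie in QA^d_m.

    Upper bound. Let F^n be contained in {∅} and suppose F has no t-transversal, but
    every subfamily of at most h sets has one. Choosing in turn a t-transversal
    X_a of A_0, ..., A_{a-1} and a set A_a of F missing X_a, one gets h + 1
    pairs with X_a meeting A_b for all b < a, but not for b = a. Branch on such
    a system: among the current indices pick the last one a, discard it, and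
    split the others according to the point of X_a that lies in A_b. Along a
    path the branching points are distinct, and a path of length n reaching two
    sets would produce two distinct members of F^n. So h + 1 is at most
    1 + t + ... + t^n.

    Lower bound. The n-subsets of an (n + t)-set have no t-transversal, but if
    one of them is removed its complement becomes a t-transversal. *)

Set Implicit Arguments.
Unset Strict Implicit.
Unset Printing Implicit Defensive.

Import Order.TTheory GRing.Theory Num.Theory.

Local Open Scope ring_scope.
Local Open Scope classical_set_scope.
Local Open Scope card_scope.
Local Open Scope nat_scope.

(** * Cardinality bounds and the trade between d and m *)

Lemma card_le_IP (T : Type) (A : set T) (n : nat) :
  A #<= `I_n -> exists f : T -> nat,
    (forall x, A x -> f x < n) /\
    (forall x y, A x -> A y -> f x = f y -> x = y).
Proof.
move=> /pcard_leP[f]; exists f; split=> [x Ax|x y Ax Ay fxy].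
  exact: (@funS _ _ _ _ f x Ax).
by apply: (inj (f := f)) fxy; rewrite inE.
Qed.

Lemma card_le_I_setD1 (T : Type) (A : set T) (x : T) (n : nat) :
  A x -> A #<= `I_n -> A `\ x #<= `I_n.-1.
Proof.
move=> Ax /card_le_IP[f [fn finj]].
(* [g] closes the gap that the removal of [x] leaves at [f x]. *)
pose g y := if f y < f x then f y else (f y).-1.
have gI y : (A `\ x) y -> f y != f x.
  by case=> Ay yx; apply/eqP => /(finj _ _ Ay Ax).
have ginj : {in A `\ x &, injective g}.
  move=> y z; rewrite !inE => yA zA; have := gI _ yA; have := gI _ zA.
  move=> fz fy gyz; apply: finj; [exact: yA.1|exact: zA.1|].
  by move: gyz; rewrite /g; do 2 case: ltnP => ?; lia.
rewrite -(card_le_eql (inj_card_eq ginj)).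
apply: subset_card_le => _ [y Axy <-] /=; have := gI _ Axy.
by rewrite /g; have := fn _ Ax; have := fn _ Axy.1; case: (ltnP (f y) (f x)); lia.
Qed.

Lemma card_le_I_setI (T : Type) (A B : set T) (n : nat) :
  A <> B -> A #<= `I_n -> B #<= `I_n -> A `&` B #<= `I_n.-1.
Proof.
have H (C D : set T) x : C #<= `I_n -> C x -> ~ D x -> C `&` D #<= `I_n.-1.
  move=> Cn Cx Dx; apply: (card_le_trans _ (card_le_I_setD1 Cx Cn)).
  by apply: subset_card_le => y [Cy Dy]; split=> // yx; apply: Dx; rewrite -yx.
move=> AB An Bn; have [/existsNP[x /not_implyP[]]|AsubB] := pselect (~ A `<=` B).
  exact: H.
have [/existsNP[x /not_implyP[]]|BsubA] := pselect (~ B `<=` A).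
  by rewrite setIC; apply: H.
by case: AB; apply/seteqP; split; apply: contrapT.
Qed.

(** Truncated subtraction is harmless: two distinct sets cannot both be empty, so for [k > d] the
    iterated family has no members. *)
Lemma dm_property_shift (d m k : nat) (T : Type) (F : set (set T)) :
  dm_property d m F -> dm_property (d - k) (m + k) F.
Proof.
move=> Fd; elim: k => [|k IH]; first by rewrite subn0 addn0.
by rewrite addnS subnS => _ [A [B [FA FB AB ->]]]; apply: card_le_I_setI => //;
  apply: IH.
Qed.

(** * Upper bound: chains, the branching tree and the greedy choice *)

Lemma iter_interSr (T : Type) (F : set (set T)) (k : nat) :
  iter_inter F k.+1 = iter_inter (iter_inter F 1) k.
Proof. by elim: k => //= k <-. Qed.

(* Intersecting consecutive sets of the chain [B] shortens it by one. *)
Lemma chain_iter_inter (T : Type) (F : set (set T)) (n : nat)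
    (B : nat -> set T) (x : nat -> T) :
  (forall i, i <= n.+1 -> F (B i)) ->
  (forall i j, i <= n.+1 -> j < i -> j < n -> B i (x j)) ->
  (forall i, i < n -> ~ B i (x i)) ->
  B n <> B n.+1 ->
  exists C D, [/\ iter_inter F n C, iter_inter F n D & C <> D].
Proof.
elim: n F B => [|n IH] F B FB Bx Bnx Bn; first by exists (B 0), (B 1); split=> //; exact: FB.
rewrite iter_interSr; apply: (IH _ (fun i => B i `&` B i.+1)).
- move=> i lin; exists (B i), (B i.+1); split=> //; try by apply: FB; lia.
  (* For [i <= n] the point [x i] separates the two sets: it lies in [B i.+1] but not in [B i]. *)
  move: lin; rewrite leq_eqVlt => /predU1P[-> //|lin] eB.
  by apply: (Bnx i) => //; rewrite eB; apply: Bx; lia.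
- by move=> i j *; split; apply: Bx; lia.
- by move=> i lin [] /(Bnx i (leqW lin)).
- move=> /seteqP[_ /(_ (x n))] sub.
  by apply: (Bnx n) => //; apply: proj1 (sub _); split; apply: Bx; lia.
Qed.

Definition geom (t r : nat) := \sum_(0 <= i < r.+1) t ^ i.

Lemma geomS (t r : nat) : geom t r.+1 = 1 + t * geom t r.
Proof.
rewrite /geom big_nat_recl// big_distrr/=; congr (_ + _).
by apply: eq_bigr => i _; rewrite expnS.
Qed.

Lemma geom_gt0 (t r : nat) : 0 < geom t r.
Proof. by case: r => [|r]; rewrite ?geomS // /geom big_nat1. Qed.

(* A node of the branching tree at depth [i] is the set [N] of the indices [a]
   such that [A a] contains the branching points [x 0, ..., x i.-1]; [B j] is
   the set that was discarded at depth [j]. *)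
Lemma skew_tree_bound (T : Type) (F : set (set T)) (n t K : nat)
    (A X : nat -> set T) :
  dm_property 0 n F ->
  (forall a, F (A a)) -> (forall a, X a #<= `I_t) ->
  (forall a, a < K -> ~ (X a `&` A a !=set0)) ->
  (forall a b, b < a < K -> X a `&` A b !=set0) ->
  forall (r i : nat) (N : {set 'I_K}) (B : nat -> set T) (x : nat -> T),
    r + i = n ->
    (forall j, j < i -> F (B j)) ->
    (forall j k, j < i -> k < j -> B j (x k)) ->
    (forall j, j < i -> ~ B j (x j)) ->
    (forall (a : 'I_K) j, a \in N -> j < i -> A a (x j)) ->
    #|N| <= geom t r.
Proof.
move=> Fn FA Xt XA XB; elim=> [|r IH] i N B x rin FB Bx Bnx AN.
  (* At depth [n] two indices [a], [b] would extend the discarded sets to a chain ending in [A a],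
     [A b], and so give two distinct members of [iter_inter F n], both empty. *)
  rewrite /geom big_nat1 leqNgt; apply/negP => /card_gt1P[a [b [aN bN ab]]].
  have Aab : A a <> A b.
    move=> eA; wlog : a b aN bN ab eA / a < b => [W|lab].
      by have := ab; rewrite neq_ltn => /orP[|] ?; [apply: (W a b)|apply: (W b a); rewrite // eq_sym].
    by apply: (XA b) => //; rewrite -eA; apply: XB; rewrite lab ltn_ord.
  move: rin; rewrite add0n => ein; subst i.
  pose B' j := if j < n then B j else if j == n then A a else A b.
  have [||||C [D [/Fn C0 /Fn D0]]] := @chain_iter_inter T F n B' x.
  - by move=> j _; rewrite /B'; case: ifP => [|_]; [exact: FB|case: ifP].
  - move=> j k _ kj kn; rewrite /B'; case: ifP => jn; first exact: Bx.
    by case: ifP => _; apply: AN.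
  - by move=> j jn; rewrite /B' jn; apply: Bnx.
  - by rewrite /B' ltnn eqxx ltnNge leqnSn /= eqn_leq ltnn.
  by case; move: C0 D0; rewrite II0 !card_le0 => /eqP-> /eqP->.
have [->|[a0 a0N]] := set_0Vmem N; first by rewrite cards0.
(* The largest index is discarded so that [X a] meets [A b] for every other [b] in [N]. *)
pose a := [arg max_(b > a0 in N) (b : nat)].
have [aN amax] : a \in N /\ forall b : 'I_K, b \in N -> b <= a.
  by rewrite /a; case: arg_maxnP.
have [f [ft finj]] := card_le_IP (Xt a).
pose Np (p : 'I_t) :=
  [set b in N | `[< exists y, [/\ X a y, A b y & f y = p] >]]%SET.
have Nsub : (N :\ a \subset \bigcup_(p : 'I_t) Np p)%SET.
  apply/fintype.subsetP => b; rewrite !finset.inE => /andP[ba bN].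
  have lba : b < a by rewrite ltn_neqAle ba amax.
  have [|y [Xy Ay]] := XB a b; first by rewrite lba ltn_ord.
  apply/finset.bigcupP; exists (Ordinal (ft _ Xy)) => //.
  by rewrite !finset.inE bN; apply/asboolP; exists y.
rewrite (cardsD1 a) aN geomS leq_add2l (leq_trans (subset_leq_card Nsub))//.
have -> : t * geom t r = \sum_(p : 'I_t) geom t r.
  by rewrite sum_nat_const card_ord.
apply: (leq_trans (n := \sum_(p : 'I_t) #|Np p|)).
  elim/big_rec2: _ => [|p s S _ sS]; first by rewrite cards0.
  by rewrite (leq_trans (leq_card_setU _ _).1)// leq_add2l.
apply: leq_sum => p _; have [->|[b]] := set_0Vmem (Np p); first by rewrite cards0.
rewrite !finset.inE => /andP[bN /asboolP[y [Xy Aby fy]]].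
(* In the child of [y] the new discarded set is [A a]; it misses the branching point [y] because [y]
   lies in [X a]. *)
pose B' j := if j < i then B j else A a; pose x' j := if j < i then x j else y.
have lt_split j : j < i.+1 -> j < i \/ j = i.
  by rewrite ltnS leq_eqVlt; case: eqP; [right|left].
apply: (IH i.+1 _ B' x'); first by rewrite addnS -addSn.
- by move=> j; rewrite /B'; case: ifP => [ji _|//]; apply: FB.
- move=> j k /lt_split[ji|->] kj; rewrite /B' /x'.
    by rewrite ji (ltn_trans kj ji); apply: Bx.
  by rewrite ltnn kj; apply: AN.
- move=> j /lt_split[ji|->]; rewrite /B' /x'; first by rewrite ji; apply: Bnx.
  by rewrite ltnn => Aay; apply: (XA a) => //; exists y.
- move=> c j; rewrite !finset.inE => /andP[cN /asboolP[z [Xz Acz fz]]].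
  move=> /lt_split[ji|->]; rewrite /x'; first by rewrite ji; apply: AN.
  by rewrite ltnn (finj y z)// fy fz.
Qed.

Lemma greedy_skew_system (T : Type) (F : set (set T)) (t h : nat) :
  (forall P, P `<=` F -> P #<= `I_h -> has_transversal t P) ->
  ~ has_transversal t F ->
  forall l, l <= h.+1 -> exists A X : nat -> set T,
    [/\ forall a, F (A a), forall a, X a #<= `I_t,
        forall a, a < l -> ~ (X a `&` A a !=set0) &
        forall a b, b < a < l -> X a `&` A b !=set0].
Proof.
move=> Ph NF; have ext X : X #<= `I_t -> exists A, F A /\ ~ (X `&` A !=set0).
  move=> Xt; apply: contrapT => /forallNP nA; apply: NF; exists X; split=> // A FA.
  by apply: contrapT => XA; apply: (nA A).
elim=> [_|l IH lh].
  (* The empty set is no transversal, so [F] has a member to fill the sequence with. *)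
  have [A [FA _]] := ext set0 (card_ge0 _ _).
  by exists (fun=> A), (fun=> set0); split=> [|a|a|a b] //; case/andP.
have [A [X [FA Xt XA XB]]] := IH (ltnW lh).
have [||Y [Yt YA]] := Ph (A @` `I_l).
- by move=> _ [a _ <-].
- apply: card_le_trans (card_image_le _ _) _.
  by rewrite card_le_II.
have [A' [FA' YA']] := ext Y Yt.
exists (fun a => if a < l then A a else A'), (fun a => if a < l then X a else Y).
split=> [a|a|a|a b /andP[ba al]]; try by case: ifP.
- by case: ifP => // al _; apply: XA.
- case: ifP => [{}al|_]; first by rewrite (ltn_trans ba al); apply: XB; rewrite ba.
  by rewrite (leq_trans ba al); apply: YA; exists b => //=; exact: leq_trans ba al.
Qed.

Lemma helly_at_geom (T : Type) (F : set (set T)) (n t : nat) :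
  dm_property 0 n F -> helly_at t F (geom t n).
Proof.
move=> Fn Ph; apply: contrapT => NF.
have [A [X [FA Xt XA XB]]] := greedy_skew_system Ph NF (leqnn _).
(* The root has no branching points; [x] only provides a default value, since [T] is not assumed
   inhabited. *)
have [x _] : X 1 `&` A 0 !=set0 by apply: XB; rewrite /= ltnS geom_gt0.
suff : #|[set: 'I_(geom t n).+1]%SET| <= geom t n by rewrite cardsT card_ord ltnn.
exact: (@skew_tree_bound T F n t _ A X Fn FA Xt XA XB n 0 _ (fun=> set0)
          (fun=> x) (addn0 n)).
Qed.

(** * Lower bound: the n-subsets of a set with n + t points *)

Lemma card_le_I_finset (T : finType) (A : {set T}) (n : nat) :
  ([set` A] #<= `I_n) = (#|A| <= n).
Proof.
have -> : [set` A] = (fun i : 'I_#|A| => enum_val i) @` [set: 'I_#|A|].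
  apply/seteqP; split=> [y yA|_ [i _ <-]]; last exact: enum_valP.
  by exists (enum_rank_in yA y) => //; rewrite enum_rankK_in.
rewrite (card_le_eql (inj_card_eq (in2W enum_val_inj))).
by rewrite -(card_le_eql card_II) card_le_II.
Qed.

Definition uniform_family (T : finType) (n : nat) : set (set T) :=
  [set B | exists A : {set T}, #|A| = n /\ B = [set` A]].

Lemma dm_property_uniform (T : finType) (d m : nat) :
  dm_property d m (@uniform_family T (d + m)).
Proof.
have h : dm_property (d + m) 0 (@uniform_family T (d + m)).
  by move=> _ [A [An ->]]; rewrite card_le_I_finset An.
by have := dm_property_shift (k := m) h; rewrite addnK.
Qed.

Lemma helly_at_uniform (n t k : nat) :
  helly_at t (@uniform_family 'I_(n + t) n) k -> 'C(n + t, n) <= k.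
Proof.
move=> hk; rewrite leqNgt; apply/negP => kC.
have [P PF Pk|X [Xt XF]] := hk.
  have [A [An PA]] : exists A : {set 'I_(n + t)}, #|A| = n /\ ~ P [set` A].
    apply: contrapT => /forallNP nA.
    suff : [set` [set A : {set 'I_(n + t)} | #|A| == n]%SET] #<= `I_k.
      by rewrite card_le_I_finset card_draws card_ord leqNgt kC.
    apply: card_le_trans Pk.
    have setinj : injective (fun A : {set 'I_(n + t)} => [set` A]).
      by move=> A B /seteqP[AB BA]; apply/setP => y; apply/idP/idP; [exact: AB|exact: BA].
    rewrite -(card_le_eql (inj_card_eq (in2W setinj))).
    apply: subset_card_le => _ [A /= + <-]; rewrite finset.inE => /eqP An.
    by apply: contrapT => PA; apply: (nA A).
  exists [set` ~: A]; split.
    by rewrite card_le_I_finset; have := cardsC A; rewrite card_ord; lia.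
  move=> B PB; have [C [Cn eB]] := PF _ PB; subst B.
  have : ~~ (C \subset A).
    apply/negP => CA; suff eCA : C = A by apply: PA; rewrite -eCA.
    by apply/eqP; rewrite eqEcard CA An Cn leqnn.
  by move=> /subsetPn[y yC yA]; exists y; split=> //=; rewrite finset.inE.
pose Y := [set y | `[< X y >]]%SET.
have eX : X = [set` Y].
  by apply/seteqP; split=> y /=; rewrite finset.inE => /asboolP.
(* Since [X] has at most [t] points, its complement contains an n-set, which [X] then misses. *)
have : 0 < #|[set A : {set 'I_(n + t)} | A \subset ~: Y & #|A| == n]|.
  rewrite cards_draws bin_gt0; move: Xt; rewrite eX card_le_I_finset.
  by have := cardsC Y; rewrite card_ord; lia.
move=> /card_gt0P[A]; rewrite finset.inE => /andP[/fintype.subsetP AY /eqP An].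
have [|y [Xy /= /AY]] := XF [set` A]; first by exists A.
by rewrite !finset.inE => /asboolP.
Qed.

Local Close Scope nat_scope.

Theorem theorem1 (R : realType) (d m t : nat) (ht : (0 < t)%N) :
  ('C(d + m + t, d + m)%:R%:E <= HG_class R t (QA d m)
     <= (\sum_(0 <= i < (d + m).+1) t ^ i)%N%:R%:E)%E.
Proof.
apply/andP; split.
  pose F := @uniform_family 'I_(d + m + t) (d + m).
  apply: (@le_trans _ _ (HG R t F)); last first.
    by apply: ereal_sup_ubound; exists 'I_(d + m + t), F; split=> //; exact: dm_property_uniform.
  rewrite /HG; case: pselect => [ex_k|_]; last exact: leey.
  case: ex_minnP => k /asboolP hk _.
  by rewrite lee_fin ler_nat; exact: helly_at_uniform hk.
(* With [k = d] the [d,m]-property becomes the [0,d+m]-property that [helly_at_geom] needs. *)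
apply: ge_ereal_sup => _ [T [F [/(dm_property_shift (k := d)) Fdm ->]]].
have hF : helly_at t F (geom t (d + m)).
  by apply: helly_at_geom; move: Fdm; rewrite subnn addnC.
rewrite /HG; case: pselect => [ex_k|[]]; last by exists (geom t (d + m)); apply/asboolP.
case: ex_minnP => k _ kmin.
by rewrite lee_fin ler_nat; apply: kmin; apply/asboolP.
Qed.
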